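(* Let $d\ge 2$ and let $$E=\{(x,|x|^2): x\in\mathbb{F}_q^{d-1}\}\subset\mathbb{F}_q^d .$$ Then $E$ is a Salem set, i.e. $|\widehat{E}(m)|\lesssim q^{-d}\sqrt{\#E}$ for every non-zero $m\in\mathbb{F}_q^d$.
   Context: $\mathbb{F}_q$ is the finite field with $q$ elements. For $x\in\mathbb{F}_q^{d-1}$, $|x|^2=x_1^2+\dots+x_{d-1}^2\in\mathbb{F}_q$. For $E\subset\mathbb{F}_q^d$, $E(y)$ denotes its characteristic function and $\#E$ its cardinality, and its Fourier transform is $\widehat{E}(m)=q^{-d}\sum_{y\in\mathbb{F}_q^d}e^{-\frac{2\pi i\,y\cdot m}{q}}E(y)$ for $m\in\mathbb{F}_q^d$, where $y\cdot m=\sum_j y_jm_j$ and $\mathbb{F}_q$ is identified with the roots of unity on the circle in the usual way. $X\lesssim Y$ means that there exists $C>0$ (independent of $q$ and $m$) such that $X\le CY$.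
   Formalization: Proved for q odd or q = 2; q = 2^k with k ≥ 2 is excluded, since there |Ê(m)| = q^{-d}#E at m = (1,…,1), so no C independent of q exists. For non-prime q the character is read as exp(-2πi Tr(t)/p). *)

(* Defs.v *)
From HB Require Import structures.
From mathcomp Require Import all_boot all_order all_algebra.
From mathcomp Require Import complex.
From mathcomp Require Import all_classical all_reals all_analysis.

Set Implicit Arguments.
Unset Strict Implicit.
Unset Printing Implicit Defensive.

Import Order.TTheory GRing.Theory Num.Theory.
Local Open Scope ring_scope.
Local Open Scope complex_scope.

Section FiniteFieldCharacter.
Variable F : finFieldType.

(* A finite field has prime-power cardinality p ^ n, so its characteristic is
   the only prime divisor of #|F|. *)
Definition ffchar : nat := pdiv #|F|.

(* Absolute trace F_q -> F_p, as an element of the prime subfield of F; it is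
   the identity when q = p. *)
Definition abs_trace (t : F) : F :=
  \sum_(i < logn ffchar #|F|) t ^+ (ffchar ^ i)%N.

(* The representative in {0, ..., p - 1} of an element of the prime subfield. *)
Definition residue (z : F) : nat :=
  find (fun a : nat => a%:R == z) (iota 0 ffchar).

End FiniteFieldCharacter.

Definition expi (R : realType) (x : R) : R[i] := cos x +i* sin x.

(* exp (- 2 pi i t / q), with F_q identified with {0, ..., q - 1} when q is
   prime; for a general prime power q = p ^ n this is read in the usual way as
   exp (- 2 pi i Tr(t) / p). *)
Definition exp_char (R : realType) (F : finFieldType) (t : F) : R[i] :=
  expi (- (2 * pi * (residue (abs_trace t))%:R / (ffchar F)%:R)).

Definition dotv (F : finFieldType) (d : nat) (y m : 'rV[F]_d) : F :=
  \sum_(j < d) y 0 j * m 0 j.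

Definition fourier (R : realType) (F : finFieldType) (d : nat)
    (E : {set 'rV[F]_d}) (m : 'rV[F]_d) : R[i] :=
  #|F|%:R ^- d * \sum_(y : 'rV[F]_d) exp_char R (dotv y m) * (y \in E)%:R.

(* The point (x, |x|^2): the insub test holds for the coordinates j < d - 1. *)
Definition parab_point (F : finFieldType) (d : nat) (x : 'rV[F]_d.-1) :
    'rV[F]_d :=
  \row_(j < d) (if (insub (val j) : option 'I_d.-1) is Some i then x 0 i
                else dotv x x).

Definition paraboloid (F : finFieldType) (d : nat) : {set 'rV[F]_d} :=
  [set parab_point x | x : 'rV[F]_d.-1].

Definition salem_bound (R : realType) (C : R) (F : finFieldType) (d : nat)
    (E : {set 'rV[F]_d}) : Prop :=
  forall m : 'rV[F]_d, m != 0 ->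
    `|fourier R E m| <= (C * (#|F|%:R ^- d * Num.sqrt #|E|%:R))%:C.

(* Main.v *)
Require Import Defs.
From mathcomp Require Import all_boot all_order all_algebra all_field.
From mathcomp Require Import complex.
From mathcomp Require Import all_classical all_reals all_analysis.
From mathcomp Require Import ring lra.

Set Implicit Arguments.
Unset Strict Implicit.
Unset Printing Implicit Defensive.

Import Order.TTheory GRing.Theory Num.Theory.
Local Open Scope ring_scope.

(** The number of points of the paraboloid is q ^ (d - 1), and its Fourier
    transform at m = (b, c) is q ^ - d times the sum S, over the x in
    F_q ^ (d - 1), of chi (x.b + c |x|^2), where chi is the canonical additive
    character.  So a bound on |S| by a multiple of q ^ ((d - 1) / 2) is what
    has to be shown.

    For odd q and c <> 0 this is the classical evaluation of a Gauss sum.  In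
    |S|^2 = S * conj S, write the first variable as y + h with y the second
    one.  With Q x = x.b + c |x|^2, the phase difference Q (y + h) - Q y is
    Q h + 2 c (y.h), whose variable part is linear in y, so by orthogonality of
    characters only h = 0 contributes, and |S|^2 is exactly q ^ (d - 1)
    ([sqr_norm_sum_char_quadratic]); this is where 2 <> 0 matters.
    If c = 0, then b <> 0 and the sum of a nontrivial linear phase vanishes
    ([sum_char_dotv_eq0]).

    This uses nothing of chi but that it is a nontrivial unimodular
    homomorphism.  The function a |-> zeta ^ a, with zeta a primitive p-th root
    of unity, depends on a mod p only, and the trace is additive with values
    in the prime subfield, which gives the homomorphism property
    ([exp_charD]); the trace is not identically zero because it is a
    polynomial of degree q / p ([abs_trace_neq0]), which gives nontriviality
    ([exp_char_neq1]).

    For q = 2 the trivial estimate |S| <= 2 ^ (d - 1) is enough, at the price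
    of a constant sqrt (2 ^ (d - 1)) that depends on d. *)

(** * Character sums over linear and quadratic phases *)

Lemma dotvDl (F : finFieldType) (n : nat) (x y z : 'rV[F]_n) :
  dotv (x + y) z = dotv x z + dotv y z.
Proof.
by rewrite -big_split; apply: eq_bigr => j _; rewrite mxE mulrDl.
Qed.

Lemma dotvC (F : finFieldType) (n : nat) (x y : 'rV[F]_n) :
  dotv x y = dotv y x.
Proof. by apply: eq_bigr => j _; rewrite mulrC. Qed.

Lemma dotvZr (F : finFieldType) (n : nat) (a : F) (x y : 'rV[F]_n) :
  dotv x (a *: y) = a * dotv x y.
Proof.
by rewrite mulr_sumr; apply: eq_bigr => j _; rewrite mxE mulrCA.
Qed.

Lemma dotv_surj (F : finFieldType) (n : nat) (u : 'rV[F]_n) (t : F) :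
  u != 0 -> exists y, dotv y u = t.
Proof.
case/rV0Pn=> j uj; exists (t / u 0 j *: delta_mx 0 j).
rewrite /dotv (bigD1 j) //= big1 ?addr0 => [|i ij]; rewrite !mxE.
  by rewrite !eqxx mulr1 divfK.
by rewrite (negbTE ij) andbF mulr0 mul0r.
Qed.

(** Orthogonality of characters: translating y by v with v.u = t multiplies the
    sum by chi t, which differs from 1. *)
Lemma sum_char_dotv_eq0 (C : numClosedFieldType) (F : finFieldType)
    (chi : F -> C) (n : nat) (u : 'rV[F]_n) :
  (forall a b, chi (a + b) = chi a * chi b) -> (exists t, chi t != 1) ->
  u != 0 -> \sum_(y : 'rV[F]_n) chi (dotv y u) = 0.
Proof.
move=> chiD [t chit] u0; have [v vu] := dotv_surj t u0.
set S := \sum_y _; apply/eqP.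
have : (chi t - 1) * S = 0.
  rewrite mulrBl mul1r; apply/eqP; rewrite subr_eq0; apply/eqP.
  rewrite mulr_sumr /S [RHS](reindex_inj (addrI v)).
  by apply: eq_bigr => y _; rewrite dotvDl chiD vu.
by move/eqP; rewrite mulf_eq0 subr_eq0 (negbTE chit).
Qed.

(** The modulus of a Gauss sum in n variables.  Expanding |S|^2 and shifting one
    variable by the other turns the quadratic phase into a linear one, to which
    orthogonality applies. *)
Lemma sqr_norm_sum_char_quadratic (C : numClosedFieldType) (F : finFieldType)
    (chi : F -> C) (n : nat) (b : 'rV[F]_n) (c : F) :
  (forall s t, chi (s + t) = chi s * chi t) -> (forall t, `|chi t| = 1) ->
  (exists t, chi t != 1) -> (2%:R * c != 0 :> F) ->
  `|\sum_(x : 'rV[F]_n) chi (dotv x b + c * dotv x x)| ^+ 2 = (#|F| ^ n)%:R.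
Proof.
move=> chiD chi1 chi_nt c0; set Q := fun x => dotv x b + c * dotv x x.
have chi_neq0 t : chi t != 0 by rewrite -normr_eq0 chi1 oner_eq0.
have chi0 : chi 0 = 1.
  by apply: (mulIf (chi_neq0 0)); rewrite mul1r -chiD addr0.
have chiJ t : (chi t)^* = chi (- t).
  apply: (mulfI (chi_neq0 t)).
  by rewrite -normCK chi1 expr1n -chiD subrr chi0.
have QD h y : Q (h + y) - Q y = Q h + dotv y (2%:R * c *: h).
  rewrite /Q dotvZr !dotvDl (dotvC h (h + y)) (dotvC y (h + y)) !dotvDl.
  by rewrite (dotvC y h); ring.
rewrite normCK rmorph_sum mulr_sumr.
transitivity (\sum_y \sum_h chi (Q h) * chi (dotv y (2%:R * c *: h))).
  apply: eq_bigr => y _; rewrite (reindex_inj (addIr y)) mulr_suml.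
  by apply: eq_bigr => h _; rewrite /= chiJ -!chiD -QD.
rewrite exchange_big (bigD1 0) //= [X in _ + X]big1 ?addr0 => [|h h0]; last first.
  by rewrite -mulr_sumr sum_char_dotv_eq0 ?mulr0 // scaler_eq0 negb_or c0.
have dot0 (y : 'rV[F]_n) : dotv y 0 = 0 by rewrite -(scale0r 0) dotvZr mul0r.
under eq_bigr => y _.
  rewrite /Q scaler0 (dotvC 0 b) !dot0 mulr0 addr0 chi0 mulr1; over.
by rewrite sumr_const card_mx mul1n.
Qed.

(** * The absolute trace and its residue *)

Lemma ffchar_pchar (F : finFieldType) : ffchar F \in [pchar F].
Proof.
have [p pp pF] := finPcharP F.
have := card_pprimeChar pF; rewrite (_ : #|_| = #|F|) // => cF.
have k0 : (0 < logn p #|F|)%N.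
  by rewrite lt0n; apply/eqP => k0; have := finNzRing_gt1 F; rewrite cF k0.
by rewrite /ffchar cF -(prednK k0) pdiv_pfactor.
Qed.

Lemma ffchar_prime (F : finFieldType) : prime (ffchar F).
Proof. exact: pcharf_prime (ffchar_pchar F). Qed.

Lemma card_ffchar (F : finFieldType) :
  #|F| = (ffchar F ^ logn (ffchar F) #|F|)%N.
Proof. exact: (card_pprimeChar (ffchar_pchar F)). Qed.

Lemma eqr_nat_pchar (F : nzRingType) (p a b : nat) :
  p \in [pchar F] -> a%:R = b%:R :> F -> a = b %[mod p].
Proof.
move=> pF; wlog ab : a b / (a <= b)%N => [H|/eqP].
  by have [/H|/ltnW/H H1 /esym/H1] := leqP a b.
by rewrite eq_sym -subr_eq0 -natrB // -(dvdn_pcharf pF) -eqn_mod_dvd // => /eqP.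
Qed.

(** The fixed points of the Frobenius map are the multiples of 1: these already
    give p roots of X^p - X, so that a further root is impossible. *)
Lemma residueK (F : finFieldType) (z : F) :
  z ^+ ffchar F = z -> (residue z)%:R = z.
Proof.
set p := ffchar F => zp; have pF : p \in [pchar F] := ffchar_pchar F.
have p_pr : prime p := ffchar_prime F.
have [zin|zout] := boolP (has (fun a : nat => a%:R == z) (iota 0 p)).
  have := nth_find 0%N zin; move: zin; rewrite has_find size_iota => zlt.
  by rewrite nth_iota // => /eqP.
pose P : {poly F} := 'X^p - 'X.
have sP : size P = p.+1.
  by rewrite size_polyDl size_polyXn // size_polyN size_polyX ltnS prime_gt1.
suff : (size (z :: map (fun a : nat => a%:R : F) (iota 0 p)) < size P)%N.
  by rewrite sP /= size_map size_iota ltnn.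
have P0 : P != 0 by rewrite -size_poly_eq0 sP.
apply: max_poly_roots => //=.
  rewrite /root !hornerE zp subrr eqxx /=; apply/allP => _ /mapP[a _ ->].
  by rewrite /root !hornerE -(pFrobenius_autE pF) rmorph_nat subrr.
apply/andP; split.
  apply: contra zout => /mapP[a ain ->].
  by apply/hasP; exists a.
rewrite map_inj_in_uniq ?iota_uniq // => a b.
rewrite !mem_iota add0n /= => alt blt /(eqr_nat_pchar pF).
by rewrite !modn_small.
Qed.

Lemma abs_traceD (F : finFieldType) (s t : F) :
  abs_trace (s + t) = abs_trace s + abs_trace t.
Proof.
rewrite -big_split; apply: eq_bigr => i _ /=.
by rewrite exprDn_pchar // (pi_pnat _ (ffchar_pchar F)) // pnatX pnat_id ?orbT //;
  exact: ffchar_prime F.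
Qed.

(** Frobenius permutes the terms t ^ (p ^ i) cyclically, as t ^ q = t; hence the
    trace lies in the prime subfield. *)
Lemma abs_trace_prime (F : finFieldType) (t : F) :
  abs_trace t ^+ ffchar F = abs_trace t.
Proof.
rewrite -(pFrobenius_autE (ffchar_pchar F)) rmorph_sum /abs_trace.
have := card_ffchar F; set k := logn _ _; case: k => [|k] cF.
  by have := finNzRing_gt1 F; rewrite cF.
rewrite big_ord_recr big_ord_recl /= addrC; congr (_ + _).
  by rewrite pFrobenius_autE -exprM -expnSr -cF expf_card.
apply: eq_bigr => i _; by rewrite pFrobenius_autE -exprM -expnSr.
Qed.

(** As a polynomial in t the trace has degree q / p, too small to vanish at all
    the q elements of the field. *)
Lemma abs_trace_neq0 (F : finFieldType) : exists t : F, abs_trace t != 0.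
Proof.
apply/existsP; apply: contraT => /existsPn tr0.
have p_gt1 := prime_gt1 (ffchar_prime F).
have := card_ffchar F; have := erefl (@abs_trace F); rewrite {2}/abs_trace.
set p := ffchar F in p_gt1 *; set k := logn _ _; case: k => [|k] trE cF.
  by have := finNzRing_gt1 F; rewrite cF.
pose P : {poly F} := \sum_(i < k.+1) 'X^(p ^ i).
have sP : size P = (p ^ k).+1.
  rewrite /P big_ord_recr /= addrC size_polyDl size_polyXn // ltnS.
  apply: (leq_trans (size_sum _ _ _)); apply/bigmax_leqP => i _ /=.
  by rewrite size_polyXn ltn_exp2l.
suff : (size (enum F) < size P)%N.
  by rewrite sP -cardE cF ltnS leqNgt ltn_exp2l // ltnSn.
apply: max_poly_roots; rewrite ?enum_uniq //.
  by rewrite -size_poly_eq0 sP.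
apply/allP => t _; rewrite /root horner_sum.
have := tr0 t; rewrite negbK trE => /eqP tr0t; rewrite -[X in _ == X]tr0t.
by apply/eqP; apply: eq_bigr => i _; rewrite !hornerE.
Qed.

(** * The canonical additive character *)

Lemma expiD (R : realType) (x y : R) : expi (x + y) = expi x * expi y.
Proof.
apply/eqP; rewrite eq_complex /= cosD sinD.
by rewrite [sin x * _ + _]addrC !eqxx.
Qed.

Lemma expi_natmul (R : realType) (x : R) (n : nat) : expi (x *+ n) = expi x ^+ n.
Proof.
elim: n => [|n IH]; last by rewrite mulrS expiD IH exprS.
by rewrite /expi cos0 sin0.
Qed.

Lemma norm_expi (R : realType) (x : R) : `|expi x| = 1.
Proof. by rewrite normc_def /= cos2Dsin2 sqrtr1. Qed.

(** The double angle 2 x turns the claim into sin x <> 0, by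
    1 - cos (2 x) = 2 sin^2 x. *)
Lemma expi_neq1 (R : realType) (x : R) : 0 < x < pi -> expi (- (x *+ 2)) != 1.
Proof.
move=> /sin_gt0_pi sx; apply/eqP => -[/eqP]; rewrite cosN cos_mulr2n => /eqP c1 _.
have := cos2Dsin2 x; have : 0 < sin x ^+ 2 by rewrite exprn_gt0.
by rewrite mulr2n in c1; lra.
Qed.

(** This is exp (- 2 pi i / p); the doubling is kept outermost to suit
    [cos_mulr2n] and [cos2pi]. *)
Definition zeta (R : realType) (F : finFieldType) : R[i] :=
  expi (- (pi / (ffchar F)%:R *+ 2)).

Lemma exp_charE (R : realType) (F : finFieldType) (t : F) :
  exp_char R t = zeta R F ^+ residue (abs_trace t).
Proof.
rewrite /exp_char /zeta -expi_natmul; congr expi.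
rewrite mulNrn; congr (- _); rewrite -mulr_natr -[in RHS]mulr_natr; ring.
Qed.

Lemma zeta_ffchar (R : realType) (F : finFieldType) : zeta R F ^+ ffchar F = 1.
Proof.
have p0 : (ffchar F)%:R != 0 :> R.
  by rewrite pnatr_eq0 -lt0n prime_gt0 // ffchar_prime.
rewrite /zeta -expi_natmul mulNrn -mulrnA mulnC mulrnA.
by rewrite -[_ *+ ffchar F]mulr_natr divfK // /expi cosN sinN cos2pi sin2pi oppr0.
Qed.

(** The residues of s, t and s + t are additive only modulo p, which suffices
    because [zeta] is a p-th root of unity. *)
Lemma exp_charD (R : realType) (F : finFieldType) (s t : F) :
  exp_char R (s + t) = exp_char R s * exp_char R t.
Proof.
rewrite !exp_charE -exprD -[LHS](expr_mod _ (zeta_ffchar R F)).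
rewrite -[RHS](expr_mod _ (zeta_ffchar R F)); congr (_ ^+ _).
apply: (eqr_nat_pchar (ffchar_pchar F)).
by rewrite natrD !residueK ?abs_trace_prime // abs_traceD.
Qed.

Lemma norm_exp_char (R : realType) (F : finFieldType) (t : F) :
  `|exp_char R t| = 1.
Proof. exact: norm_expi. Qed.

Lemma exp_char_neq1 (R : realType) (F : finFieldType) :
  exists t : F, exp_char R t != 1.
Proof.
have [t trt] := abs_trace_neq0 F; exists t.
have p0 : (0 < ffchar F)%N := prime_gt0 (ffchar_prime F).
set r := residue (abs_trace t).
have r0 : (0 < r %% ffchar F)%N.
  rewrite lt0n; apply: contra trt => /eqP r0.
  rewrite -(residueK (abs_trace_prime t)) -/r.
  by rewrite -(GRing.natr_mod_pchar (ffchar_pchar F)) r0.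
have rp : (r %% ffchar F < ffchar F)%N.
  by rewrite ltn_mod.
rewrite exp_charE -/r -(expr_mod _ (zeta_ffchar R F)) /zeta -expi_natmul.
rewrite mulNrn -mulrnA mulnC mulrnA; apply: expi_neq1.
rewrite -[_ *+ (r %% _)]mulr_natr mulrAC divr_gt0 ?mulr_gt0 ?pi_gt0 ?ltr0n //=.
by rewrite ltr_pdivrMr ?ltr0n // ltr_pM2l ?pi_gt0 // ltr_nat.
Qed.

(** * The paraboloid *)

Lemma parab_point_widen (F : finFieldType) (n : nat) (x : 'rV[F]_n) (i : 'I_n) :
  @parab_point F n.+1 x 0 (widen_ord (leqnSn n) i) = x 0 i.
Proof. by rewrite mxE /= valK. Qed.

Lemma parab_point_max (F : finFieldType) (n : nat) (x : 'rV[F]_n) :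
  @parab_point F n.+1 x 0 ord_max = dotv x x.
Proof. by rewrite mxE /= insubF // ltnn. Qed.

Lemma parab_point_inj (F : finFieldType) (n : nat) :
  injective (@parab_point F n.+1).
Proof.
move=> x y xy; apply/rowP => i.
by rewrite -(parab_point_widen x) xy parab_point_widen.
Qed.

Lemma card_paraboloid (F : finFieldType) (n : nat) :
  #|paraboloid F n.+1| = (#|F| ^ n)%N.
Proof. by rewrite card_imset ?card_mx ?mul1n //; exact: parab_point_inj. Qed.

(** Parametrizing the paraboloid by its first coordinates turns its Fourier
    transform into a character sum with a quadratic phase. *)
Lemma fourier_paraboloid (R : realType) (F : finFieldType) (n : nat)
    (m : 'rV[F]_n.+1) :
  fourier R (paraboloid F n.+1) m =
  #|F|%:R ^- n.+1 * \sum_(x : 'rV[F]_n)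
    exp_char R (dotv x (\row_i m 0 (widen_ord (leqnSn n) i)) +
                m 0 ord_max * dotv x x).
Proof.
rewrite /fourier; congr (_ * _).
under eq_bigr do rewrite mulr_natr mulrb.
rewrite -big_mkcond big_imset /=; last by move=> x y _ _; exact: parab_point_inj.
apply: eq_bigr => x _; congr exp_char; rewrite /dotv big_ord_recr /=.
congr (_ + _); last by rewrite parab_point_max mulrC.
by apply: eq_bigr => i _; rewrite parab_point_widen mxE.
Qed.

(** Oddness of q enters only through 2 <> 0: in characteristic 2 the phase
    c |x|^2 is additive in x and can cancel the linear part. *)
Lemma parabolic_sum_sqr_le (C : numClosedFieldType) (F : finFieldType)
    (chi : F -> C) (n : nat) (b : 'rV[F]_n) (c : F) :
  (forall s t, chi (s + t) = chi s * chi t) -> (forall t, `|chi t| = 1) ->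
  (exists t, chi t != 1) -> odd #|F| -> (b != 0) || (c != 0) ->
  `|\sum_(x : 'rV[F]_n) chi (dotv x b + c * dotv x x)| ^+ 2 <= (#|F| ^ n)%:R.
Proof.
move=> chiD chi1 chi_nt oF; have [-> /=|c0 _] := eqVneq c 0.
  rewrite orbF => b0; under eq_bigr do rewrite mul0r addr0.
  by rewrite sum_char_dotv_eq0 // normr0 expr0n ler0n.
rewrite sqr_norm_sum_char_quadratic // mulf_neq0 //.
rewrite -(dvdn_pcharf (ffchar_pchar F)).
rewrite dvdn_prime2 ?(ffchar_prime F) //.
apply: contraL oF => /eqP F2.
by rewrite -dvdn2 -F2 pdiv_dvd.
Qed.

Lemma normc_le_sqrt (R : realType) (z : R[i]) (k : nat) :
  `|z| ^+ 2 <= k%:R -> `|z| <= (Num.sqrt k%:R : R)%:C%C.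
Proof.
move=> zk; have s0 : 0 <= (Num.sqrt k%:R : R)%:C%C by rewrite lecR sqrtr_ge0.
rewrite -(@ler_pXn2r _ 2) ?nnegrE ?normr_ge0 //.
by rewrite -[leRHS]rmorphXn /= sqr_sqrtr ?ler0n // rmorph_nat.
Qed.

(* The Salem constant C is chosen before the field: it depends neither on q
   nor on m. *)
Theorem lemma3p2 (R : realType) (d : nat) (hd : (2 <= d)%N) :
  exists C : R, 0 < C /\
    forall F : finFieldType, odd #|F| \/ #|F| = 2%N ->
      salem_bound C (paraboloid F d).
Proof.
case: d hd => // n _; exists (Num.sqrt (2 ^ n)%:R); split.
  by rewrite sqrtr_gt0 ltr0n expn_gt0.
move=> F Fodd2 m m0; rewrite fourier_paraboloid card_paraboloid.
set S := \sum_x _.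
have S2 : `|S| ^+ 2 <= (2 ^ n * #|F| ^ n)%:R.
  have [Fodd|F2] := Fodd2.
    apply: (@le_trans _ _ (#|F| ^ n)%:R).
      apply: parabolic_sum_sqr_le => //; try exact: exp_charD.
      - exact: norm_exp_char.
      - exact: exp_char_neq1.
      apply: contra_neqT m0; rewrite negb_or !negbK => /andP[/eqP b0 /eqP c0].
      apply/rowP => j; rewrite mxE; case: (unliftP ord_max j) => [i|] ->; last exact: c0.
      have /rowP/(_ i) := b0; rewrite !mxE => <-; congr (m _ _).
      by apply: val_inj; rewrite /= /bump leqNgt ltn_ord.
    by rewrite ler_nat leq_pmull // expn_gt0.
  (* |S|^2 <= q ^ n * q ^ n, and for q = 2 the first factor is 2 ^ n *)
  have leS : `|S| <= (#|F| ^ n)%:R.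
    apply: (le_trans (ler_norm_sum _ _ _)).
    under eq_bigr do rewrite norm_exp_char.
    by rewrite sumr_const card_mx mul1n.
  by rewrite F2 in leS *; rewrite natrM -expr2 lerXn2r ?nnegrE.
rewrite mulrCA -sqrtrM ?ler0n // -natrM rmorphM /= normrM.
have -> : `|#|F|%:R ^- n.+1 : R[i]| = (#|F|%:R ^- n.+1)%:C%C.
  by rewrite normfV normrX normr_nat fmorphV rmorphXn rmorph_nat.
apply: ler_wpM2l; last exact: normc_le_sqrt.
by rewrite lecR invr_ge0 exprn_ge0 ?ler0n.
Qed.
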